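(* Let $\mathcal{X}_N\subset\mathbb{R}^n$ be a finite set, let $\mathbf{g}:\mathcal{X}_N\to\mathbb{R}^q$ be the target function, let $\mathscr{M}$ be a finite set of sensors with measurement functions $\mathbf{m}_j:\mathcal{X}_N\to\mathbb{R}^{d_j}$, $j\in\mathscr{M}$, and let $\gamma>0$. Then for every $\mathscr{S}\subseteq\mathscr{M}$ and every constant $0<\alpha<1$, $$\tilde f_{\alpha\gamma}(\mathscr{S})\ \geq\ \frac{1}{1-\alpha^2}\left[f_\gamma(\mathscr{S})-\alpha^2F_\infty\right].$$ Furthermore, $$F_{\alpha\gamma}(\mathscr{S})\ \leq\ \frac{1}{1-\alpha^2}\left[F_\infty-f_\gamma(\mathscr{S})\right].$$
   Context: For $\mathscr{S}=\{j_1,\dots,j_K\}\subseteq\mathscr{M}$, $\mathbf{m}_{\mathscr{S}}(\mathbf{x})=(\mathbf{m}_{j_1}(\mathbf{x}),\dots,\mathbf{m}_{j_K}(\mathbf{x}))$ is the concatenation of the selected measurements, so $\Vert\mathbf{m}_{\mathscr{S}}(\mathbf{x})-\mathbf{m}_{\mathscr{S}}(\mathbf{x}')\Vert_2^2=\sum_{j\in\mathscr{S}}\Vert\mathbf{m}_j(\mathbf{x})-\mathbf{m}_j(\mathbf{x}')\Vert_2^2$. For a threshold $\gamma>0$ define $\tilde w_{\gamma,\mathbf{x},\mathbf{x}'}(\mathscr{S})=1$ if $\Vert\mathbf{m}_{\mathscr{S}}(\mathbf{x})-\mathbf{m}_{\mathscr{S}}(\mathbf{x}')\Vert_2\geq\gamma$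 and $0$ otherwise; $w_{\gamma,\mathbf{x},\mathbf{x}'}(\mathscr{S})=\min\left\{\frac{1}{\gamma^2}\Vert\mathbf{m}_{\mathscr{S}}(\mathbf{x})-\mathbf{m}_{\mathscr{S}}(\mathbf{x}')\Vert_2^2,\ 1\right\}$; $\tilde f_\gamma(\mathscr{S})=\sum_{\mathbf{x},\mathbf{x}'\in\mathcal{X}_N}\tilde w_{\gamma,\mathbf{x},\mathbf{x}'}(\mathscr{S})\Vert\mathbf{g}(\mathbf{x})-\mathbf{g}(\mathbf{x}')\Vert_2^2$ (rigid objective); $f_\gamma(\mathscr{S})=\sum_{\mathbf{x},\mathbf{x}'\in\mathcal{X}_N}w_{\gamma,\mathbf{x},\mathbf{x}'}(\mathscr{S})\Vert\mathbf{g}(\mathbf{x})-\mathbf{g}(\mathbf{x}')\Vert_2^2$ (relaxed objective); $F_\gamma(\mathscr{S})=\sum_{\mathbf{x},\mathbf{x}'\in\mathcal{X}_N:\ \Vert\mathbf{m}_{\mathscr{S}}(\mathbf{x})-\mathbf{m}_{\mathscr{S}}(\mathbf{x}')\Vert_2<\gamma}\Vert\mathbf{g}(\mathbf{x})-\mathbf{g}(\mathbf{x}')\Vert_2^2$ (total undetectable differences); $F_\infty=\sum_{\mathbf{x},\mathbf{x}'\in\mathcal{X}_N}\Vert\mathbf{g}(\mathbf{x})-\mathbf{g}(\mathbf{x}')\Vert_2^2$ (total fluctuation). *)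

(* Defs.v *)
From mathcomp Require Import all_boot all_order all_algebra.
From mathcomp Require Import finmap reals.

Set Implicit Arguments.
Unset Strict Implicit.
Unset Printing Implicit Defensive.

Import Order.TTheory GRing.Theory Num.Theory.
Local Open Scope ring_scope.

(* Euclidean norm; the library's norm on 'rV[R]_n is the sup norm. *)
Definition norm2 (R : realType) (n : nat) (v : 'rV[R]_n) : R :=
  Num.sqrt (\sum_(i < n) v 0 i ^+ 2).

(* Below, T is the type of the elements of the finite set over which the sums
   range, and m j is the measurement function of sensor j. *)

(* Concatenation (m_(j_1) x, ..., m_(j_K) x) for S = {j_1, ..., j_K}, the
   elements of S being listed in the order of enum S. *)
Definition msel (R : realType) (T M : finType) (d : M -> nat)
    (m : forall j : M, T -> 'rV[R]_(d j)) (S : {set M}) (x : T) :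
    'rV[R]_(\sum_(k < #|S|) d (enum_val k)) :=
  \mxrow_(k < #|S|) m (enum_val k) x.

Definition mdist (R : realType) (T M : finType) (d : M -> nat)
    (m : forall j : M, T -> 'rV[R]_(d j)) (S : {set M}) (x x' : T) : R :=
  norm2 (msel m S x - msel m S x').

Definition w_rigid (R : realType) (T M : finType) (d : M -> nat)
    (m : forall j : M, T -> 'rV[R]_(d j)) (gamma : R) (x x' : T)
    (S : {set M}) : R :=
  if gamma <= mdist m S x x' then 1 else 0.

Definition w_relaxed (R : realType) (T M : finType) (d : M -> nat)
    (m : forall j : M, T -> 'rV[R]_(d j)) (gamma : R) (x x' : T)
    (S : {set M}) : R :=
  Num.min (1 / gamma ^+ 2 * mdist m S x x' ^+ 2) 1.

Definition f_rigid (R : realType) (T M : finType) (q : nat) (d : M -> nat)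
    (g : T -> 'rV[R]_q) (m : forall j : M, T -> 'rV[R]_(d j)) (gamma : R)
    (S : {set M}) : R :=
  \sum_(x : T) \sum_(x' : T)
    w_rigid m gamma x x' S * norm2 (g x - g x') ^+ 2.

Definition f_relaxed (R : realType) (T M : finType) (q : nat) (d : M -> nat)
    (g : T -> 'rV[R]_q) (m : forall j : M, T -> 'rV[R]_(d j)) (gamma : R)
    (S : {set M}) : R :=
  \sum_(x : T) \sum_(x' : T)
    w_relaxed m gamma x x' S * norm2 (g x - g x') ^+ 2.

Definition F_undetectable (R : realType) (T M : finType) (q : nat)
    (d : M -> nat) (g : T -> 'rV[R]_q)
    (m : forall j : M, T -> 'rV[R]_(d j)) (gamma : R) (S : {set M}) : R :=
  \sum_(x : T) \sum_(x' : T | mdist m S x x' < gamma) norm2 (g x - g x') ^+ 2.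

Definition F_total (R : realType) (T : finType) (q : nat)
    (g : T -> 'rV[R]_q) : R :=
  \sum_(x : T) \sum_(x' : T) norm2 (g x - g x') ^+ 2.

(* Main.v *)
Require Import Defs.
From mathcomp Require Import all_boot all_order all_algebra.
From mathcomp Require Import finmap reals.
From mathcomp Require Import lra.

Import Order.TTheory GRing.Theory Num.Theory.
Local Open Scope ring_scope.

(** Fix a pair of points and let [D] be the distance between their selected
    measurements.  Either [alpha * gamma <= D], and the relaxed weight is at
    most [1], or [D < alpha * gamma], and the relaxed weight is at most
    [D ^+ 2 / gamma ^+ 2 <= alpha ^+ 2].  In both cases the relaxed weight at
    [gamma] is at most the convex combination
    [alpha ^+ 2 * 1 + (1 - alpha ^+ 2) * w] of [1] and the rigid weight [w] at
    [alpha * gamma] (lemma [w_relaxed_le]).  Weighting by the squared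
    differences of [g] and summing over all pairs gives
    [f_relaxed <= alpha ^+ 2 * F_total + (1 - alpha ^+ 2) * f_rigid], which is
    the first inequality multiplied by [1 - alpha ^+ 2 > 0].

    The second inequality is the first one rewritten: a pair is either detected
    or undetected at a given threshold, so [F_total] is the sum of [f_rigid] and
    [F_undetectable] (lemma [f_rigid_add_F_undetectable]). *)

(** The right-hand side is [1] for a pair that is detected at the threshold
    [alpha * gamma] and [alpha ^+ 2] for one that is not; the two terms of the
    minimum defining the relaxed weight bound it in the respective cases. *)
Lemma w_relaxed_le (R : realType) (T M : finType) (d : M -> nat)
    (m : forall j : M, T -> 'rV[R]_(d j)) (gamma alpha : R) (x x' : T)
    (S : {set M}) :
  0 < gamma -> 0 <= alpha <= 1 ->
  w_relaxed m gamma x x' S <=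
    alpha ^+ 2 + (1 - alpha ^+ 2) * w_rigid m (alpha * gamma) x x' S.
Proof.
move=> gamma_gt0 /andP[alpha_ge0 alpha_le1]; rewrite /w_relaxed /w_rigid.
have D_ge0 : 0 <= mdist m S x x' by exact: sqrtr_ge0.
case: (leP (alpha * gamma)) => [_|D_lt]; rewrite ge_min.
  by apply/orP; right; lra.
apply/orP; left; rewrite mulr0 addr0 mul1r mulrC ler_pdivrMr ?exprn_gt0//.
rewrite -exprMn ler_sqr ?nnegrE ?mulr_ge0//; exact: ltW.
Qed.

Lemma f_relaxed_le (R : realType) (T M : finType) (q : nat) (d : M -> nat)
    (g : T -> 'rV[R]_q) (m : forall j : M, T -> 'rV[R]_(d j))
    (gamma alpha : R) (S : {set M}) :
  0 < gamma -> 0 <= alpha <= 1 ->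
  f_relaxed g m gamma S <=
    alpha ^+ 2 * F_total g + (1 - alpha ^+ 2) * f_rigid g m (alpha * gamma) S.
Proof.
move=> gamma_gt0 alpha01; rewrite /f_relaxed /F_total /f_rigid.
rewrite !mulr_sumr -big_split; apply: ler_sum => x _.
rewrite !mulr_sumr -big_split; apply: ler_sum => x' _ /=.
rewrite [X in _ <= _ + X]mulrA -mulrDl ler_wpM2r ?sqr_ge0//; exact: w_relaxed_le.
Qed.

Lemma f_rigid_add_F_undetectable (R : realType) (T M : finType) (q : nat)
    (d : M -> nat) (g : T -> 'rV[R]_q)
    (m : forall j : M, T -> 'rV[R]_(d j)) (gamma : R) (S : {set M}) :
  f_rigid g m gamma S + F_undetectable g m gamma S = F_total g.
Proof.
rewrite /f_rigid /F_undetectable -big_split; apply: eq_bigr => x _ /=.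
rewrite [X in _ + X]big_mkcond -big_split; apply: eq_bigr => x' _ /=.
by rewrite /w_rigid; case: leP => _; rewrite ?mul1r ?mul0r ?addr0 ?add0r.
Qed.

Lemma f_rigid_ge (R : realType) (T M : finType) (q : nat)
    (d : M -> nat) (g : T -> 'rV[R]_q)
    (m : forall j : M, T -> 'rV[R]_(d j)) (gamma alpha : R) (S : {set M}) :
  0 < gamma -> 0 <= alpha < 1 ->
  1 / (1 - alpha ^+ 2) * (f_relaxed g m gamma S - alpha ^+ 2 * F_total g) <=
    f_rigid g m (alpha * gamma) S.
Proof.
move=> gamma_gt0 /andP[alpha_ge0 alpha_lt1].
have c_gt0 : 0 < 1 - alpha ^+ 2 by rewrite subr_gt0 expr_lt1.
have alpha01 : 0 <= alpha <= 1 by rewrite alpha_ge0 ltW.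
have relaxed_le := f_relaxed_le R T M q d g m gamma alpha S gamma_gt0 alpha01.
by rewrite [1 / _ * _]mulrAC ler_pdivrMr// mul1r; lra.
Qed.

Lemma F_undetectable_le (R : realType) (T M : finType) (q : nat)
    (d : M -> nat) (g : T -> 'rV[R]_q)
    (m : forall j : M, T -> 'rV[R]_(d j)) (gamma alpha : R) (S : {set M}) :
  0 < gamma -> 0 <= alpha < 1 ->
  F_undetectable g m (alpha * gamma) S <=
    1 / (1 - alpha ^+ 2) * (F_total g - f_relaxed g m gamma S).
Proof.
move=> gamma_gt0 /andP[alpha_ge0 alpha_lt1].
have c_gt0 : 0 < 1 - alpha ^+ 2 by rewrite subr_gt0 expr_lt1.
have alpha01 : 0 <= alpha <= 1 by rewrite alpha_ge0 ltW.
have relaxed_le := f_relaxed_le R T M q d g m gamma alpha S gamma_gt0 alpha01.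
rewrite [1 / _ * _]mulrAC ler_pdivlMr// mul1r.
move: relaxed_le.
by rewrite -(f_rigid_add_F_undetectable R T M q d g m (alpha * gamma) S); lra.
Qed.

Theorem theorem4p3 (R : realType) (n q : nat) (X : {fset 'rV[R]_n})
    (g : X -> 'rV[R]_q) (M : finType) (d : M -> nat)
    (m : forall j : M, X -> 'rV[R]_(d j)) (gamma : R) (hgamma : 0 < gamma)
    (S : {set M}) (alpha : R) (halpha0 : 0 < alpha) (halpha1 : alpha < 1) :
  f_rigid g m (alpha * gamma) S
    >= 1 / (1 - alpha ^+ 2) * (f_relaxed g m gamma S - alpha ^+ 2 * F_total g)
  /\
  F_undetectable g m (alpha * gamma) S
    <= 1 / (1 - alpha ^+ 2) * (F_total g - f_relaxed g m gamma S).
Proof.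
have alpha01 : 0 <= alpha < 1 by rewrite ltW.
by split; [exact: f_rigid_ge | exact: F_undetectable_le].
Qed.
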